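(* Consider the $\beta$-biased exclusion process on $\{1,\ldots,n\}$ with $k$ particles, where $\beta=\beta_n>0$ and $k=k_n$ satisfies $k/n\to\rho\le1/2$, and let $t_{\rm mix}(\varepsilon)$ be its mixing time. If $n\beta\to\zeta$, where $0\le\zeta<\infty$, then (as $n\to\infty$, for $\varepsilon\in(0,1)$) $$t_{\rm mix}(\varepsilon)\ \ge\ \frac{n^3}{\pi^2+\zeta^2}\,[1+o(1)]\,\Bigl(\log n+\log\bigl[(1-\varepsilon)/\varepsilon\bigr]\Bigr).$$
   Context: The $\beta$-biased exclusion process on $\{1,\ldots,n\}$ with $k$ particles is the discrete-time Markov chain on the set of configurations $\sigma\in\{0,1\}^n$ with exactly $k$ ones (particles), with the following transitions. At each step choose one of the $n-1$ edges $\{i,i+1\}$ of the path uniformly at random. If both endpoints are occupied or both are vacant, do nothing. If exactly one endpoint is occupied, place the particle on the right vertex $i+1$ with probability $p=(1+\beta)/2$ and on the left vertex $i$ with probability $q=(1-\beta)/2$. This chain is reversible and ergodic with a unique stationary distribution; call it $\mu$ (so that $\pi$ in the claim is the number $3.14\ldots$). The mixing time is $$t_{\rm mix}(\varepsilon)=\min\{t\ge 0:\ \max_{\sigma}\|\mathbf P_\sigma(X_t\in\cdot)-\mu\|_{\rm TV}<\varepsilon\}.$$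
   Formalization: The limiting density ρ is assumed positive (0 < ρ ≤ 1/2); for ρ = 0 the claim as stated fails, e.g. with k = 0 (one state, mixing time 0) or k = 1 (mixing time of order n^3 without the log n factor). *)

(* Defs.v *)
(* World: MathComp with MathComp-Analysis. *)
From mathcomp Require Import all_boot all_order all_algebra.
From mathcomp Require Import all_classical all_reals all_analysis.

Set Implicit Arguments.
Unset Strict Implicit.
Unset Printing Implicit Defensive.

Import Order.TTheory GRing.Theory Num.Theory.
Import numFieldNormedType.Exports.

Local Open Scope classical_set_scope.
Local Open Scope ring_scope.

Section FiniteMarkovChain.
Context {R : realType} {S : finType}.
Implicit Types (P : S -> S -> R) (mu nu : S -> R).

Definition step P mu : S -> R := fun y => \sum_(x : S) mu x * P x y.

Definition law P (x : S) (t : nat) : S -> R :=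
  iter t (step P) (fun y => (y == x)%:R).

Definition stationary_distribution P mu : Prop :=
  [/\ forall x, 0 <= mu x, \sum_(x : S) mu x = 1 & step P mu =1 mu].

(* The default value 0 of the maximum is harmless: all terms are nonnegative. *)
Definition tv_dist mu nu : R :=
  \big[Num.max/0]_(A : {set S}) `| \sum_(x in A) mu x - \sum_(x in A) nu x |.

Definition worst_tv P mu (t : nat) : R :=
  \big[Num.max/0]_(x : S) tv_dist (law P x t) mu.

(* A nonempty set of naturals attains its infimum, so this is a minimum;
   it is +oo when the chain never gets eps-close to mu. *)
Definition tmix P mu (eps : R) : \bar R :=
  ereal_inf [set t%:R%:E | t in [set t : nat | worst_tv P mu t < eps]].

End FiniteMarkovChain.

(* Sites are numbered from 0 to n-1; true marks a particle. *)
Definition config (n k : nat) : finType :=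
  {s : {ffun 'I_n -> bool} | #|[pred i | s i]| == k}.

(* For distinct i, j : vacate i and occupy j. *)
Definition place_at (n : nat) (i j : 'I_n) (s : {ffun 'I_n -> bool}) :
    {ffun 'I_n -> bool} :=
  [ffun x => if x == j then true else if x == i then false else s x].

(* Transition probability from s to s' given that the edge {i, j}, with j to
   the right of i, has been chosen. *)
Definition edge_kernel (R : realType) (beta : R) (n k : nat) (i j : 'I_n)
    (s s' : config n k) : R :=
  if val s i == val s j then (s' == s)%:R
  else (1 + beta) / 2 * (val s' == place_at i j (val s))%:R
     + (1 - beta) / 2 * (val s' == place_at j i (val s))%:R.

Definition exclusion_kernel (R : realType) (beta : R) (n k : nat)
    (s s' : config n k) : R :=
  \sum_(i < n) \sum_(j < n | j == i.+1 :> nat)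
    n.-1%:R^-1 * edge_kernel beta i j s s'.

(* Main.v *)
(* Wilson's second-moment method.  With a = (1+b)/(1-b) the ratio of the jump
   probabilities and H_x the number of particles on the first x sites, a is a
   root of q y^2 - y + p, which makes the mean of a^(H_x) after resampling the
   edge at x equal to p a^(H_(x-1)) + q a^(H_(x+1)) in all four local patterns
   (the discrete Cole-Hopf transform).  Hence sum_x w_x a^(H_x), with w the
   Dirichlet eigenvector c^x sin(pi x/n), c = a^(-1/2), of the transposed
   recursion, is up to a constant an eigenfunction, with spectral gap
   (1 - sqrt(1-b^2) cos(pi/n))/(n-1) ~ (pi^2 + zeta^2)/(2 n^3).  Divided by a-1,
   it changes by O(1) in each step, whereas it differs by order n^2 between the
   configurations with all particles to the left and all to the right.  Its
   variance at any time and at stationarity is O(1/gap) = O(n^3), so total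
   variation stays close to 1 while (1-gap)^(2t) n^4 >> n^3. *)
Require Import Defs.
From mathcomp Require Import all_boot all_order all_algebra.
From mathcomp Require Import all_classical all_reals all_analysis.
From mathcomp Require Import ring lra zify.

Set Implicit Arguments.
Unset Strict Implicit.
Unset Printing Implicit Defensive.

Import Order.TTheory GRing.Theory Num.Theory.
Import numFieldNormedType.Exports.

Local Open Scope classical_set_scope.
Local Open Scope ring_scope.

Lemma sum_step (R : realType) (S : finType) (P : S -> S -> R) (nu f : S -> R) :
  \sum_y step P nu y * f y = \sum_x nu x * \sum_y P x y * f y.
Proof.
under eq_bigr do rewrite mulr_suml.
rewrite exchange_big /=; apply: eq_bigr => x _.
by rewrite mulr_sumr; apply: eq_bigr => y _; rewrite mulrA.
Qed.

Section Wilson.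
Variables (R : realType) (S : finType) (P : S -> S -> R).
Variables (Phi : S -> R) (lam V : R).
Hypothesis P_ge0 : forall x y, 0 <= P x y.
Hypothesis P_sum : forall x, \sum_y P x y = 1.
Hypothesis lam_ge0 : 0 <= lam.
Hypothesis lam_lt1 : lam < 1.
Hypothesis Phi_eigen : forall x, \sum_y P x y * Phi y = lam * Phi x.
Hypothesis Phi_jump : forall x, \sum_y P x y * (Phi y - Phi x) ^+ 2 <= V.

Lemma kernel_sqr_le x : \sum_y P x y * Phi y ^+ 2 <= lam ^+ 2 * Phi x ^+ 2 + V.
Proof.
have -> : \sum_y P x y * Phi y ^+ 2 = \sum_y P x y * (Phi y - Phi x) ^+ 2
   + 2 * Phi x * (\sum_y P x y * Phi y) - Phi x ^+ 2 * \sum_y P x y.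
  rewrite !mulr_sumr -big_split -sumrB /=; apply: eq_bigr => y _; ring.
rewrite Phi_eigen P_sum.
have := Phi_jump x; have := sqr_ge0 ((1 - lam) * Phi x); nra.
Qed.

Lemma law_ge0 x t y : 0 <= law P x t y.
Proof.
rewrite /law; elim: t y => [|t IH] y /=; first exact: ler0n.
by apply: sumr_ge0 => z _; apply: mulr_ge0.
Qed.

Lemma law_sum1 x t : \sum_y law P x t y = 1.
Proof.
rewrite /law; elim: t => [|t IH] /=.
  by rewrite (bigD1 x) //= eqxx big1 ?addr0 // => y /negbTE ->.
rewrite -[RHS]IH; under eq_bigr do rewrite -[step _ _ _]mulr1.
rewrite (sum_step P _ (fun=> 1)); apply: eq_bigr => z _.
by under eq_bigr do rewrite mulr1; rewrite P_sum mulr1.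
Qed.

Lemma law_mean x t : \sum_y law P x t y * Phi y = lam ^+ t * Phi x.
Proof.
rewrite /law; elim: t => [|t IH] /=.
  rewrite (bigD1 x) //= eqxx mul1r big1 ?addr0 ?mul1r // => y /negbTE ->.
  by rewrite mul0r.
rewrite sum_step; under eq_bigr do rewrite Phi_eigen mulrCA.
by rewrite -mulr_sumr IH exprS mulrA.
Qed.

Let W := V / (1 - lam ^+ 2).

Lemma Wilson_var_fix : lam ^+ 2 * W + V = W.
Proof.
have h : 0 < 1 - lam ^+ 2 by rewrite subr_gt0 expr_lt1.
by rewrite /W; field; rewrite gt_eqF.
Qed.

Lemma step_second_moment (nu : S -> R) : (forall x, 0 <= nu x) ->
  \sum_x nu x = 1 ->
  \sum_y step P nu y * Phi y ^+ 2 <= lam ^+ 2 * (\sum_x nu x * Phi x ^+ 2) + V.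
Proof.
move=> nu0 nu1; rewrite sum_step.
rewrite -[V]mul1r -nu1 mulr_suml mulr_sumr -big_split /=.
apply: ler_sum => x _; rewrite mulrCA -mulrDr.
exact: ler_wpM2l (kernel_sqr_le x).
Qed.

Lemma law_second_moment x t :
  \sum_y law P x t y * Phi y ^+ 2 <= (lam ^+ t * Phi x) ^+ 2 + W.
Proof.
elim: t => [|t IH].
  rewrite /law /= (bigD1 x) //= eqxx mul1r big1 ?addr0 ?mul1r; last first.
    by move=> y /negbTE ->; rewrite mul0r.
  rewrite lerDl divr_ge0 //; last by rewrite subr_ge0 expr_le1 // ltW.
  apply: le_trans (Phi_jump x); apply: sumr_ge0 => y _.
  by rewrite mulr_ge0 // sqr_ge0.
have := step_second_moment (law_ge0 x t) (law_sum1 x t) => h.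
apply: le_trans h _.
have -> : lam ^+ t.+1 * Phi x = lam * (lam ^+ t * Phi x) by rewrite exprS mulrA.
rewrite exprMn.
rewrite -[in leRHS]Wilson_var_fix addrA lerD2r -mulrDr.
by apply: ler_wpM2l; first exact: sqr_ge0.
Qed.

Lemma stationary_second_moment mu : stationary_distribution P mu ->
  \sum_y mu y * Phi y ^+ 2 <= W.
Proof.
case=> mu0 mu1 muP; have := step_second_moment mu0 mu1.
under eq_bigr do rewrite muP.
have := Wilson_var_fix; have : lam ^+ 2 < 1 by rewrite expr_lt1.
nra.
Qed.

Lemma Wilson_tv mu x t : stationary_distribution P mu ->
  lam ^+ t * Phi x != 0 ->
  1 - 8 * W / (lam ^+ t * Phi x) ^+ 2 <= tv_dist (law P x t) mu.
Proof.
move=> mustat; have [mu0 mu1 muP] := mustat.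
set m := lam ^+ t * Phi x => m0; set nu := law P x t.
have m2 : 0 < m ^+ 2 by rewrite exprn_even_gt0.
(* Phi^2 + (Phi - m)^2 >= m^2 / 2, so Phi^2 >= m^2 / 4 on A and
   (Phi - m)^2 >= m^2 / 4 off A. *)
pose A := [set y | (Phi y - m) ^+ 2 < Phi y ^+ 2]%SET.
have nu_dev : \sum_y nu y * (Phi y - m) ^+ 2 <= W.
  have -> : \sum_y nu y * (Phi y - m) ^+ 2 = \sum_y nu y * Phi y ^+ 2
     - 2 * m * (\sum_y nu y * Phi y) + m ^+ 2 * \sum_y nu y.
    rewrite !mulr_sumr -sumrB -big_split /=; apply: eq_bigr => y _; ring.
  rewrite law_mean law_sum1 -/m.
  by have := law_second_moment x t; rewrite -/m -/nu; nra.
have muA : \sum_(y in A) mu y * m ^+ 2 <= 4 * W.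
  have h := stationary_second_moment mustat.
  apply: (@le_trans _ _ (4 * \sum_y mu y * Phi y ^+ 2)); last by rewrite ler_pM2l.
  rewrite [X in _ <= _ * X](bigID (mem A)) /= mulrDr.
  rewrite -[leLHS]addr0 lerD //; last first.
    apply: mulr_ge0 => //; apply: sumr_ge0 => y _.
    by rewrite mulr_ge0 // sqr_ge0.
  rewrite mulr_sumr; apply: ler_sum => y; rewrite inE => yA.
  rewrite [leRHS]mulrCA; apply: ler_wpM2l => //.
  by have := sqr_ge0 (2 * Phi y - m); nra.
have nuA : \sum_(y in ~: A) nu y * m ^+ 2 <= 4 * W.
  apply: (@le_trans _ _ (4 * \sum_y nu y * (Phi y - m) ^+ 2)).
    rewrite [X in _ <= _ * X](bigID (mem (~: A))) /= mulrDr.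
    rewrite -[leLHS]addr0 lerD //; last first.
      apply: mulr_ge0 => //; apply: sumr_ge0 => y _.
      by rewrite mulr_ge0 ?law_ge0 // sqr_ge0.
    rewrite mulr_sumr; apply: ler_sum => y; rewrite !inE -leNgt => yA.
    rewrite [leRHS]mulrCA; apply: ler_wpM2l; first exact: law_ge0.
    by have := sqr_ge0 (2 * Phi y - m); nra.
  by rewrite ler_pM2l.
have nuT : \sum_(y in A) nu y + \sum_(y in ~: A) nu y = 1.
  rewrite -(law_sum1 x t) [RHS](bigID (mem A)) /=; congr (_ + _).
  by apply: eq_bigl => y; rewrite inE.
apply: (@le_trans _ _ (\sum_(y in A) nu y - \sum_(y in A) mu y)).
  rewrite -!mulr_suml in muA nuA.
  have -> : 8 * W / m ^+ 2 = 4 * W / m ^+ 2 + 4 * W / m ^+ 2 by ring.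
  rewrite -ler_pdivlMr // in muA; rewrite -ler_pdivlMr // in nuA.
  by lra.
apply: le_trans (ler_norm _) _.
exact: (le_bigmax_cond 0 (fun A : {set S} =>
  `| \sum_(x in A) nu x - \sum_(x in A) mu x |)).
Qed.

End Wilson.

Definition height (n : nat) (s : {ffun 'I_n -> bool}) (x : nat) : nat :=
  \sum_(l < n | (l < x)%N) s l.

Section Configurations.
Variables n k : nat.
Implicit Types (s : {ffun 'I_n -> bool}) (i j : 'I_n).

Lemma card_height s : #|[pred i | s i]| = height s n.
Proof.
rewrite /height -sum1_card big_mkcond /= [RHS](eq_bigl xpredT).
  by apply: eq_bigr => l _; rewrite unfold_in /=; case: (s l).
by move=> l; rewrite ltn_ord.
Qed.

Lemma height0 s : height s 0 = 0%N.
Proof. by rewrite /height big_pred0. Qed.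

Lemma heightS s (l : 'I_n) : height s l.+1 = (height s l + s l)%N.
Proof.
rewrite /height (bigD1 l) ?ltnS //= addnC; congr (_ + _)%N.
by apply: eq_bigl => y; rewrite ltnS [RHS]ltn_neqAle andbC.
Qed.

Lemma height_config (s : config n k) : height (val s) n = k.
Proof. by rewrite -card_height; apply/eqP; exact: (valP s). Qed.

Lemma height_place i j s x : s i != s j -> (j < x)%N = (i < x)%N ->
  height (place_at i j s) x = height s x.
Proof.
move=> sij jix; have ij : i != j by apply: contraNN sij => /eqP ->.
rewrite /height; case: (boolP (i < x)%N) => ix; last first.
  apply: eq_bigr => l lx; rewrite ffunE.
  by case: eqP => [lj|_]; [rewrite lj jix (negbTE ix) in lx|
     case: eqP => // li; rewrite li (negbTE ix) in lx].
rewrite (bigD1 j) ?jix //= (bigD1 i) ?ix ?ij //=.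
rewrite [RHS](bigD1 j) ?jix //= [X in (_ = _ + X)%N](bigD1 i) ?ix ?ij //=.
rewrite !ffunE !eqxx (negbTE ij) !addnA; congr (_ + _)%N; last first.
  by apply: eq_bigr => l /andP[/andP[_ /negbTE lj] /negbTE li]; rewrite ffunE lj li.
by move: sij; case: (s i); case: (s j).
Qed.

Lemma height_place_left i j s : j = i.+1 :> nat -> s i != s j ->
  height (place_at j i s) j = (height s i).+1.
Proof.
move=> ji sij; rewrite ji heightS ffunE eqxx addn1; congr _.+1.
rewrite height_place ?ji ?ltnn //; first by rewrite eq_sym.
by rewrite ltnNge leqnSn.
Qed.

Lemma height_place_right i j s : j = i.+1 :> nat -> s i != s j ->
  height (place_at i j s) j = height s i.
Proof.
move=> ji sij; rewrite ji heightS ffunE eqxx.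
have -> : (i == j) = false by apply/eqP => ij; rewrite -ij in ji; lia.
rewrite addn0 height_place // ltnn ji.
by rewrite ltnNge leqnSn.
Qed.

Lemma place_card i j s : s i != s j -> #|[pred l | s l]| == k ->
  #|[pred l | place_at i j s l]| == k.
Proof. by move=> sij; rewrite !card_height height_place // !ltn_ord. Qed.

End Configurations.

Section Kernel.
Variables (R : realType) (beta : R) (m k : nat).
Local Notation n := m.+1.
Implicit Types (F : {ffun 'I_n -> bool} -> R) (s : config n k).

Lemma sum_config_eq F (f : {ffun 'I_n -> bool}) : #|[pred l | f l]| == k ->
  \sum_(s : config n k) (val s == f)%:R * F (val s) = F f.
Proof.
move=> fk; rewrite (bigD1 (exist _ f fk : config n k)) //= eqxx mul1r.
rewrite big1 ?addr0 // => s /negbTE; rewrite -val_eqE /= => ->.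
by rewrite mul0r.
Qed.

Definition edge_mean F i j (s : {ffun 'I_n -> bool}) : R :=
  if s i == s j then F s
  else (1 + beta) / 2 * F (place_at i j s) + (1 - beta) / 2 * F (place_at j i s).

Lemma sum_edge_kernel F i j s :
  \sum_(s' : config n k) edge_kernel beta i j s s' * F (val s') =
  edge_mean F i j (val s).
Proof.
rewrite /edge_kernel /edge_mean; case: ifPn => sij.
  rewrite -[RHS](@sum_config_eq F (val s)) //; exact: (valP s).
rewrite -!(@sum_config_eq F (place_at _ _ _)); first last.
- by apply: place_card => //; exact: (valP s).
- by apply: place_card; [rewrite eq_sym|exact: (valP s)].
rewrite !mulr_sumr -big_split /=; apply: eq_bigr => s' _.
by rewrite mulrDl !mulrA.
Qed.

Lemma sum_edges (G : 'I_n -> 'I_n -> R) :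
  \sum_(i < n) \sum_(j < n | j == i.+1 :> nat) G i j =
  \sum_(x < m) G (widen_ord (leqnSn m) x) (lift ord0 x).
Proof.
rewrite big_ord_recr /= [X in _ + X]big1 ?addr0; last first.
  by move=> j /eqP jm; have := ltn_ord j; rewrite jm ltnn.
by apply: eq_bigr => x _; rewrite (big_pred1 (lift ord0 x)).
Qed.

Lemma sum_exclusion_kernel F s :
  \sum_(s' : config n k) exclusion_kernel beta s s' * F (val s') =
  m%:R^-1 * \sum_(x < m) edge_mean F (widen_ord (leqnSn m) x) (lift ord0 x) (val s).
Proof.
rewrite /exclusion_kernel; under eq_bigr do rewrite sum_edges mulr_suml.
rewrite exchange_big mulr_sumr /=; apply: eq_bigr => x _.
by rewrite -sum_edge_kernel mulr_sumr; apply: eq_bigr => s' _; rewrite mulrA.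
Qed.

Lemma exclusion_kernel_ge0 s s' : -1 <= beta <= 1 -> 0 <= exclusion_kernel beta s s'.
Proof.
move=> b; apply: sumr_ge0 => i _; apply: sumr_ge0 => j _.
apply: mulr_ge0; first by rewrite invr_ge0.
rewrite /edge_kernel; case: ifP => // _.
by apply: addr_ge0; apply: mulr_ge0 => //; lra.
Qed.

Lemma exclusion_kernel_sum1 s : (0 < m)%N ->
  \sum_(s' : config n k) exclusion_kernel beta s s' = 1.
Proof.
move=> m0; have := sum_exclusion_kernel (fun=> 1) s.
under eq_bigr do rewrite mulr1.
move=> ->; under eq_bigr => x _.
  have -> : edge_mean (fun=> 1) (widen_ord (leqnSn m) x) (lift ord0 x) (val s) = 1.
    by rewrite /edge_mean; case: ifP => // _; field.
  over.
by rewrite sumr_const card_ord mulVf // pnatr_eq0 -lt0n.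
Qed.

End Kernel.

Lemma sum_by_parts (R : comRingType) (p q : R) (w u : nat -> R) (m : nat) :
  \sum_(x < m) w x.+1 * (p * u x + q * u x.+2) =
  \sum_(x < m) (p * w x.+2 + q * w x) * u x.+1
  + (p * w 1%N * u 0%N - p * w m.+1 * u m - q * w 0%N * u 1%N + q * w m * u m.+1).
Proof.
elim: m => [|m IH]; first by rewrite !big_ord0; ring.
by rewrite !big_ord_recr /= IH; ring.
Qed.

Section Eigenfunction.
Variables (R : realType) (beta : R) (m k : nat).
Hypotheses (beta_gt0 : 0 < beta) (beta_lt1 : beta < 1) (m_gt0 : (0 < m)%N).
Local Notation n := m.+1.
Implicit Types (f : {ffun 'I_n -> bool}) (s : config n k).

Definition asym : R := (1 + beta) / (1 - beta).
Definition damp : R := Num.sqrt (1 - beta ^+ 2) / (1 + beta).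
Definition weight (x : nat) : R := damp ^+ x * sin (pi * x%:R / n%:R).
(* The division by asym - 1 makes the increments of order 1 uniformly as beta tends to 0. *)
Definition wheight f : R :=
  (\sum_(x < m) weight x.+1 * asym ^+ height f x.+1) / (asym - 1).
Definition edge_eigen : R := Num.sqrt (1 - beta ^+ 2) * cos (pi / n%:R).
Definition eigen : R := 1 - (1 - edge_eigen) / m%:R.

Local Notation p := ((1 + beta) / 2).
Local Notation q := ((1 - beta) / 2).

Lemma onem_sqr_gt0 : 0 < 1 - beta ^+ 2.
Proof. by rewrite subr_gt0 expr_lt1 // ltW. Qed.

Let onep_neq0 : 1 + beta != 0.
Proof. by rewrite gt_eqF // addr_gt0. Qed.

Let onem_neq0 : 1 - beta != 0.
Proof. by rewrite gt_eqF // subr_gt0. Qed.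

Lemma sqr_sqrt1B : Num.sqrt (1 - beta ^+ 2) ^+ 2 = 1 - beta ^+ 2.
Proof. by rewrite sqr_sqrtr // ltW // onem_sqr_gt0. Qed.

Lemma asym_gt1 : 1 < asym.
Proof. have := (beta_gt0, beta_lt1) => -[b0 b1]; rewrite /asym ltr_pdivlMr; lra. Qed.

Lemma damp_gt0 : 0 < damp.
Proof. by rewrite divr_gt0 ?sqrtr_gt0 ?onem_sqr_gt0 // addr_gt0. Qed.

Lemma damp_sqr : damp ^+ 2 = asym^-1.
Proof.
rewrite /damp /asym expr_div_n sqr_sqrt1B invf_div.
have h1 := onep_neq0.
by field.
Qed.

Lemma damp_le1 : damp <= 1.
Proof.
have : damp ^+ 2 <= 1 by rewrite damp_sqr invf_cp1 ?ltW ?asym_gt1 // (lt_trans _ asym_gt1).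
by rewrite expr_le1 // ltW // damp_gt0.
Qed.

Lemma weight0 : weight 0 = 0.
Proof. by rewrite /weight mulr0 mul0r sin0 mulr0. Qed.

Lemma weight_n : weight n = 0.
Proof. by rewrite /weight mulfK ?pnatr_eq0 // sinpi mulr0. Qed.

Lemma weight_norm x : `|weight x| <= 1.
Proof.
rewrite normrM -[1]mulr1; apply: ler_pM => //.
  have d0 := ltW damp_gt0.
  by rewrite ger0_norm ?exprn_ge0 // exprn_ile1 ?damp_le1.
by rewrite ler_norml sin_geN1 sin_le1.
Qed.

Lemma weight_rec x : p * weight x.+2 + q * weight x = edge_eigen * weight x.+1.
Proof.
have n0 : n%:R != 0 :> R by rewrite pnatr_eq0.
rewrite /weight /edge_eigen.
have -> : pi * x.+2%:R / n%:R = pi * x.+1%:R / n%:R + pi / n%:R :> R.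
  by rewrite -[x.+2]addn1 natrD; ring.
have -> : pi * x%:R / n%:R = pi * x.+1%:R / n%:R - pi / n%:R :> R.
  by rewrite -[x.+1]addn1 natrD; ring.
rewrite sinD sinB !(exprS damp) /damp.
set S := sin _; set C1 := cos _; set S1 := sin _; set C := cos _.
have := sqr_sqrt1B; set r := Num.sqrt _ => hr.
have h1 := onep_neq0.
set d := (r / (1 + beta)) ^+ x.
have r2 : r * r = (1 - beta) * (1 + beta) by rewrite -expr2 hr; ring.
have e1 : p * (r / (1 + beta) * (r / (1 + beta))) = q.
  have -> : p * (r / (1 + beta) * (r / (1 + beta))) = (r * r) / (1 + beta) / 2.
    by field.
  by rewrite r2; field.
have e2 : r * (r / (1 + beta)) = 1 - beta by rewrite mulrA r2; field.
transitivity (p * (r / (1 + beta) * (r / (1 + beta))) * d * (S * C1 + C * S1)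
   + q * d * (S * C1 - C * S1)); first by ring.
transitivity (r * (r / (1 + beta)) * d * S * C1); last by ring.
by rewrite e1 e2; field.
Qed.

Lemma wheight_diff f f' (x : 'I_m) :
  (forall y, y != x.+1 -> height f' y = height f y) ->
  wheight f' - wheight f =
  weight x.+1 * ((asym ^+ height f' x.+1 - asym ^+ height f x.+1) / (asym - 1)).
Proof.
move=> ff'; rewrite /wheight -mulrBl mulrA; congr (_ / _).
rewrite -sumrB (bigD1 x) //= big1 ?addr0 ?mulrBr // => y yx.
by rewrite ff' ?subrr // eqSS.
Qed.

Section OneEdge.
Variables (f : {ffun 'I_n -> bool}) (x : 'I_m).
Local Notation i := (widen_ord (leqnSn m) x).
Local Notation j := (lift ord0 x).

Lemma lift0E : j = i.+1 :> nat. Proof. by []. Qed.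

Lemma wheight_place_right : f i != f j -> wheight (place_at i j f) - wheight f =
  weight x.+1 * ((asym ^+ height f x - asym ^+ height f x.+1) / (asym - 1)).
Proof.
move=> fij; rewrite (@wheight_diff _ _ x).
  by rewrite -[X in height (place_at _ _ _) X]/(nat_of_ord j) height_place_right.
by move=> y yx; rewrite height_place // lift0E /=; move: yx; clear; lia.
Qed.

Lemma wheight_place_left : f i != f j -> wheight (place_at j i f) - wheight f =
  weight x.+1 * ((asym ^+ (height f x).+1 - asym ^+ height f x.+1) / (asym - 1)).
Proof.
move=> fij; rewrite (@wheight_diff _ _ x).
  by rewrite -[X in height (place_at _ _ _) X]/(nat_of_ord j) height_place_left.
by move=> y yx; rewrite height_place 1?eq_sym // lift0E /=; move: yx; clear; lia.
Qed.

Lemma edge_mean_wheight : edge_mean beta wheight i j f - wheight f =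
  weight x.+1 * ((p * asym ^+ height f x + q * asym ^+ height f x.+2
                  - asym ^+ height f x.+1) / (asym - 1)).
Proof.
have -> : edge_mean beta wheight i j f - wheight f =
   if f i == f j then 0 else p * (wheight (place_at i j f) - wheight f)
     + q * (wheight (place_at j i f) - wheight f).
  by rewrite /edge_mean; case: ifP => _; field.
have hi : height f x.+1 = (height f x + f i)%N := heightS f i.
have hj : height f x.+2 = (height f x + f i + f j)%N by rewrite -hi; exact: (heightS f j).
case: ifP => [/eqP fij|/negbT fij].
  rewrite hj hi -fij; case: (f i); rewrite ?addn0 ?addn1 ?exprS.
    have h1 := onem_neq0.
    have h2 : p + q * (asym * asym) = asym by rewrite /asym; field.
    set A := asym ^+ _.
    have -> : p * A + q * (asym * (asym * A)) - asym * A = (p + q * (asym * asym) - asym) * A.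
      by ring.
    by rewrite h2; ring.
  have h3 : p + q = 1 by field.
  by rewrite -mulrDl h3; ring.
have a1 : asym - 1 != 0 by rewrite subr_eq0 gt_eqF // asym_gt1.
rewrite wheight_place_right // wheight_place_left //.
move: fij; rewrite hj hi; case: (f i); case: (f j) => //= _;
  rewrite ?addn0 ?addn1 ?exprS; field; exact: a1.
Qed.

Lemma wheight_jump (f' : {ffun 'I_n -> bool}) : f i != f j ->
  f' = place_at i j f \/ f' = place_at j i f ->
  (wheight f' - wheight f) ^+ 2 <= asym ^+ (2 * n).
Proof.
move=> fij hf'.
have a1 : asym - 1 != 0 by rewrite subr_eq0 gt_eqF // asym_gt1.
have [d [d1 ->]] : exists d : R, `|d| <= 1 /\
    wheight f' - wheight f = weight x.+1 * (d * asym ^+ height f x).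
  have hi : height f x.+1 = (height f x + f i)%N := heightS f i.
  case: hf' => ->; rewrite ?wheight_place_right ?wheight_place_left // hi;
    case: (f i); rewrite ?addn1 ?addn0 ?subrr ?mul0r.
  - exists (-1); rewrite normrN1; split=> //; congr (_ * _); rewrite exprS.
    by field.
  - by exists 0; rewrite normr0 ler01 !mul0r.
  - by exists 0; rewrite normr0 ler01 !mul0r.
  - exists 1; rewrite normr1; split=> //; congr (_ * _); rewrite exprS.
    by field.
rewrite mulnC exprM -real_normK ?num_real //.
rewrite ler_sqr ?nnegrE ?exprn_ge0 ?(ltW (lt_trans ltr01 asym_gt1)) //.
have a0 : 0 <= asym := ltW (lt_trans ltr01 asym_gt1).
rewrite normrM [X in _ * X]normrM -[leRHS]mul1r.
apply: ler_pM; rewrite ?mulr_ge0 ?weight_norm //.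
rewrite -[leRHS]mul1r; apply: ler_pM => //.
rewrite ger0_norm ?exprn_ge0 //; rewrite ler_eXn2l ?asym_gt1 //.
rewrite /height; apply: leq_trans (_ : \sum_(l < n) 1 <= n)%N; last first.
  by rewrite sum1_card card_ord.
by rewrite big_mkcond; apply: leq_sum => l _; case: ifP => // _; case: (f l).
Qed.

End OneEdge.

Lemma kernel_wheight_jump s :
  \sum_(s' : config n k) exclusion_kernel beta s s' *
     (wheight (val s') - wheight (val s)) ^+ 2 <= asym ^+ (2 * n).
Proof.
rewrite (@sum_exclusion_kernel _ beta m k (fun f => (wheight f - wheight (val s)) ^+ 2)).
rewrite ler_pdivrMl ?ltr0n // -[X in _ <= X%:R * _](card_ord m) -sumr_const mulr_suml.
apply: ler_sum => x _; rewrite mul1r /edge_mean; case: ifPn => fij.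
  by rewrite subrr expr0n exprn_ge0 // ltW // (lt_trans ltr01 asym_gt1).
have h1 := wheight_jump fij (or_introl erefl).
have h2 := wheight_jump fij (or_intror erefl).
have b0 := beta_gt0; have b1 := beta_lt1; nra.
Qed.

Lemma kernel_wheight : exists b : R, forall s,
  \sum_(s' : config n k) exclusion_kernel beta s s' * wheight (val s') =
  eigen * wheight (val s) + b.
Proof.
have m0 : m%:R != 0 :> R by rewrite pnatr_eq0 -lt0n.
have a1 : asym - 1 != 0 by rewrite subr_eq0 gt_eqF // asym_gt1.
exists (m%:R^-1 * ((p * weight 1 + q * weight m * asym ^+ k) / (asym - 1))) => s.
rewrite sum_exclusion_kernel.
have -> : \sum_(x < m) edge_mean beta wheight (widen_ord (leqnSn m) x) (lift ord0 x) (val s)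
   = m%:R * wheight (val s) + \sum_(x < m) weight x.+1 * ((p * asym ^+ height (val s) x
   + q * asym ^+ height (val s) x.+2 - asym ^+ height (val s) x.+1) / (asym - 1)).
  rewrite -[X in X%:R * _](card_ord m) -sumr_const mulr_suml -big_split /=.
  by apply: eq_bigr => x _; rewrite -edge_mean_wheight mul1r addrC subrK.
have -> : \sum_(x < m) weight x.+1 * ((p * asym ^+ height (val s) x
   + q * asym ^+ height (val s) x.+2 - asym ^+ height (val s) x.+1) / (asym - 1))
   = (edge_eigen - 1) * wheight (val s)
     + (p * weight 1 + q * weight m * asym ^+ k) / (asym - 1).
  under eq_bigr do rewrite mulrA mulrBr.
  rewrite -mulr_suml sumrB (sum_by_parts p q weight (fun y => asym ^+ height (val s) y)).
  under eq_bigr do rewrite weight_rec -mulrA.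
  rewrite -mulr_sumr height0 height_config weight0 weight_n /wheight.
  by ring.
rewrite /eigen; set B := (_ + _ * _ * _) / _; set W := wheight _; by field.
Qed.

End Eigenfunction.

Lemma height_prefix (n k x : nat) : (x <= n)%N ->
  height [ffun i : 'I_n => (i < k)%N] x = minn x k.
Proof.
elim: x => [|x IH] xn; first by rewrite height0 min0n.
rewrite (heightS _ (Ordinal xn)) /= (IH (ltnW xn)) ffunE /=.
by case: (ltnP x k) => /=; lia.
Qed.

Lemma height_suffix (n l x : nat) : (x <= n)%N ->
  height [ffun i : 'I_n => (l <= i)%N] x = (x - l)%N.
Proof.
elim: x => [|x IH] xn; first by rewrite height0 sub0n.
rewrite (heightS _ (Ordinal xn)) /= (IH (ltnW xn)) ffunE /=.
by case: (leqP l x) => /=; lia.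
Qed.

Lemma extreme_configs (n k : nat) : (k <= n)%N ->
  exists s1 s2 : config n k, forall x, (x <= n)%N ->
    height (val s1) x = minn x k /\ height (val s2) x = (x - (n - k))%N.
Proof.
move=> kn.
have h1 : #|[pred i | [ffun i : 'I_n => (i < k)%N] i]| == k.
  by rewrite card_height height_prefix //; apply/eqP; lia.
have h2 : #|[pred i | [ffun i : 'I_n => (n - k <= i)%N] i]| == k.
  by rewrite card_height height_suffix //; apply/eqP; lia.
pose config_of (f : {ffun 'I_n -> bool}) (h : #|[pred i | f i]| == k) : config n k :=
  exist _ f h.
exists (config_of _ h1), (config_of _ h2) => x xn.
by rewrite /= height_prefix // height_suffix.
Qed.

Lemma bernoulli (R : realDomainType) (a : R) d : 1 <= a -> 1 + d%:R * (a - 1) <= a ^+ d.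
Proof.
move=> a1; elim: d => [|d IH]; first by rewrite expr0 mul0r addr0.
rewrite exprS -natr1.
have d0 : 0 <= d%:R :> R by [].
have : 0 <= d%:R * (a - 1) by rewrite mulr_ge0 // subr_ge0.
nra.
Qed.

Lemma expr_diff_ge (R : realDomainType) (a : R) (M N L : nat) :
  1 <= a -> (N + L <= M)%N -> L%:R * (a - 1) <= a ^+ M - a ^+ N.
Proof.
move=> a1 NL; have -> : M = (N + (M - N))%N by lia.
rewrite exprD -[X in _ <= _ - X]mulr1 -mulrBr.
have h1 : 1 <= a ^+ N by rewrite exprn_ege1.
have h2 : L%:R * (a - 1) <= a ^+ (M - N) - 1.
  rewrite lerBrDl; apply: le_trans (bernoulli _ a1).
  by rewrite lerD2l ler_wpM2r ?subr_ge0 // ler_nat; lia.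
have : 0 <= L%:R * (a - 1) by rewrite mulr_ge0 // subr_ge0.
nra.
Qed.

Lemma sin_ge_away (R : realType) (y : R) : pi / 8 <= y <= pi - pi / 8 ->
  sin (pi / 8) <= sin y.
Proof.
move=> /andP[y1 y2]; have p0 := pi_gt0 R.
rewrite -(cosBpihalf y) -(cosBpihalf (pi / 8)) -cos_norm -[leRHS]cos_norm.
rewrite ltr0_norm; last by lra.
have : `|y - pi / 2| <= - (pi / 8 - pi / 2) by rewrite ler_norml; apply/andP; split; lra.
rewrite le_eqVlt => /predU1P[->//|h]; apply: ltW.
rewrite ltr_cos // in_itv /=; apply/andP; split => //; lra.
Qed.

Section Separation.
Variables (R : realType) (beta : R) (m k : nat).
Hypotheses (beta_gt0 : 0 < beta) (beta_lt1 : beta < 1).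
Local Notation n := m.+1.

Lemma weight_ge0 x : (x <= n)%N -> 0 <= weight beta m x.
Proof.
move=> xn; apply: mulr_ge0; first by rewrite exprn_ge0 // ltW // damp_gt0.
apply: sin_ge0_pi; rewrite divr_ge0 ?mulr_ge0 ?pi_ge0 //=.
by rewrite ler_pdivrMr ?ltr0n // ler_wpM2l ?pi_ge0 // ler_nat.
Qed.

Lemma weight_ge x : (n <= 8 * x)%N -> (4 * x <= 3 * n)%N ->
  damp beta ^+ n * sin (pi / 8) <= weight beta m x.
Proof.
move=> nx xn; have p0 := pi_gt0 R.
have n0 : 0 < n%:R :> R by rewrite ltr0n.
have d0 := damp_gt0 beta_gt0 beta_lt1.
apply: ler_pM.
- by rewrite exprn_ge0 // ltW.
- by apply: sin_ge0_pi; apply/andP; split; lra.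
- by rewrite ler_wiXn2l ?damp_le1 // ?ltW //; lia.
have nx' : n%:R <= 8 * x%:R :> R by rewrite -natrM ler_nat.
have xn' : 4 * x%:R <= 3 * n%:R :> R by rewrite -!natrM ler_nat.
apply: sin_ge_away; rewrite ler_pdivlMr // ler_pdivrMr //; apply/andP; split; nra.
Qed.

Lemma wheight_separation (L : nat) : (7 <= m)%N ->
  (L <= n %/ 4)%N -> (L <= k)%N -> (L + k <= n)%N ->
  exists s1 s2 : config n k,
    (2 * (n %/ 4))%:R * (damp beta ^+ n * sin (pi / 8) * L%:R)
      <= wheight beta (val s1) - wheight beta (val s2).
Proof.
move=> m7 Ln Lk Lkn.
have [|s1 [s2 hs]] := @extreme_configs n k; first by lia.
exists s1, s2.
have a1 := asym_gt1 beta_gt0 beta_lt1.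
have a10 : 0 < asym beta - 1 by rewrite subr_gt0.
set a := asym beta in a1 a10 *.
pose g x := weight beta m x * ((a ^+ height (val s1) x - a ^+ height (val s2) x) / (a - 1)).
have -> : wheight beta (val s1) - wheight beta (val s2) = \sum_(1 <= x < n) g x.
  rewrite big_add1 /= big_mkord /wheight -mulrBl -sumrB mulr_suml.
  by apply: eq_bigr => x _; rewrite /g mulrA mulrBr.
set h := (n %/ 4)%N.
have hn : (4 * h <= n < 4 * h + 4)%N by rewrite /h; lia.
have gge x d : (x <= n)%N -> (x - (n - k) + d <= minn x k)%N ->
    weight beta m x * d%:R <= g x.
  move=> xn hx; apply: ler_wpM2l; first exact: weight_ge0.
  rewrite ler_pdivlMr //; apply: expr_diff_ge; first exact: ltW.
  by have [-> ->] := hs x xn.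
have g0 x : (x <= n)%N -> 0 <= g x.
  by move=> xn; have := gge x 0%N xn; rewrite mulr0; apply; lia.
rewrite (@big_cat_nat _ _ _ h) //=; try lia.
rewrite [X in _ + X](@big_cat_nat _ _ _ (3 * h)) //=; try lia.
have h1 : 0 <= \sum_(1 <= x < h) g x.
  by rewrite big_nat; apply: sumr_ge0 => x hx; apply: g0; lia.
have h2 : 0 <= \sum_(3 * h <= x < n) g x.
  by rewrite big_nat; apply: sumr_ge0 => x hx; apply: g0; lia.
have h3 : (2 * h)%:R * (damp beta ^+ n * sin (pi / 8) * L%:R)
   <= \sum_(h <= x < 3 * h) g x.
  have -> : (2 * h)%N = (3 * h - h)%N by lia.
  rewrite mulr_natl -sumr_const_nat; apply: ler_sum_nat => x hx.
  apply: (@le_trans _ _ (weight beta m x * L%:R)); last by apply: gge; lia.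
  by apply: ler_wpM2r => //; apply: weight_ge; lia.
by lra.
Qed.

End Separation.

Section LowerBound.
Variables (R : realType) (beta : R) (m k : nat).
Hypotheses (beta_gt0 : 0 < beta) (beta_lt1 : beta < 1) (m_gt0 : (0 < m)%N).
Local Notation n := m.+1.
Local Notation P := (@exclusion_kernel R beta n k).
Local Notation lam := (eigen beta m).

Lemma exclusion_tv_lower (s1 s2 : config n k) (mu : config n k -> R) (D : R) (t : nat) :
  0 < lam -> lam < 1 -> 0 < D ->
  D <= wheight beta (val s1) - wheight beta (val s2) ->
  stationary_distribution P mu ->
  1 - 32 * asym beta ^+ (2 * n) / ((1 - lam ^+ 2) * lam ^+ t ^+ 2 * D ^+ 2)
    <= worst_tv P mu t.
Proof.
move=> l0 l1 D0 Ds mustat.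
have [b hb] := kernel_wheight k beta_gt0 beta_lt1 m_gt0.
pose Phi (s : config n k) := wheight beta (val s) - b / (1 - lam).
have P0 s s' : 0 <= P s s'.
  by apply: exclusion_kernel_ge0; have := beta_gt0; have := beta_lt1; lra.
have P1 s : \sum_s' P s s' = 1 by exact: exclusion_kernel_sum1.
have Phi_eigen s : \sum_s' P s s' * Phi s' = lam * Phi s.
  under eq_bigr do rewrite mulrBr.
  rewrite sumrB hb -mulr_suml P1 /Phi; field.
  by rewrite subr_eq0 gt_eqF.
have Phi_jump s : \sum_s' P s s' * (Phi s' - Phi s) ^+ 2 <= asym beta ^+ (2 * n).
  apply: le_trans (kernel_wheight_jump beta_gt0 beta_lt1 m_gt0 s).
  rewrite le_eqVlt; apply/orP; left; apply/eqP; apply: eq_bigr => s' _.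
  by congr (_ * _ ^+ 2); rewrite /Phi; ring.
have [s hs] : exists s, (D / 2) ^+ 2 <= Phi s ^+ 2.
  have hD : D <= Phi s1 - Phi s2.
    by apply: le_trans Ds _; rewrite /Phi; lra.
  have [h|h] := leP ((D / 2) ^+ 2) (Phi s1 ^+ 2); first by exists s1.
  exists s2.
  have : Phi s1 < D / 2 by have D1 := D0; nra.
  move=> h'; rewrite -[leRHS]sqrrN ler_sqr ?nnegrE; lra.
have lt0 : 0 < lam ^+ t by rewrite exprn_gt0.
have lt2 : 0 < 1 - lam ^+ 2 by rewrite subr_gt0 expr_lt1 // ltW.
have Ps0 : 0 < Phi s ^+ 2 by apply: lt_le_trans hs; rewrite exprn_gt0 // divr_gt0.
have Phis : lam ^+ t * Phi s != 0.
  apply: mulf_neq0; first by rewrite gt_eqF.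
  apply/eqP => h0; move: Ps0.
  by rewrite h0 expr0n ltxx.
have W := Wilson_tv P0 P1 (ltW l0) l1 Phi_eigen Phi_jump mustat Phis.
apply: (@le_trans _ _ (tv_dist (law P s t) mu)); last first.
  exact: (le_bigmax_cond 0 (fun x => tv_dist (law P x t) mu)).
apply: le_trans W; rewrite lerD2l lerN2.
set a2 := asym beta ^+ _.
have a20 : 0 < a2.
  by rewrite exprn_gt0 // (lt_trans _ (asym_gt1 beta_gt0 beta_lt1)).
have -> : 8 * (a2 / (1 - lam ^+ 2)) / (lam ^+ t * Phi s) ^+ 2 =
   8 * a2 / ((1 - lam ^+ 2) * lam ^+ t ^+ 2 * Phi s ^+ 2).
  by rewrite exprMn !invfM; ring.
have -> : 32 * a2 / ((1 - lam ^+ 2) * lam ^+ t ^+ 2 * D ^+ 2) =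
   8 * a2 / ((1 - lam ^+ 2) * lam ^+ t ^+ 2 * (D / 2) ^+ 2).
  by rewrite expr_div_n !invfM invrK; ring.
apply: ler_wpM2l; first by rewrite mulr_ge0 // ltW.
have c0 : 0 < (1 - lam ^+ 2) * lam ^+ t ^+ 2 by rewrite mulr_gt0 // exprn_gt0.
rewrite lef_pV2 ?posrE; first by rewrite ler_pM2l.
- by rewrite mulr_gt0.
- by rewrite mulr_gt0 // exprn_gt0 // divr_gt0.
Qed.

End LowerBound.

Lemma cvg_invn (R : realType) : (fun n : nat => n%:R^-1 : R) @ \oo --> (0 : R).
Proof. by rewrite -cvg_shiftS; exact: cvg_harmonic. Qed.

Lemma cvg_near_eq (R : realType) (f g : nat -> R) (l : R) :
  f @ \oo --> l -> (\forall n \near \oo, f n = g n) -> g @ \oo --> l.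
Proof.
move=> fl fg; apply: cvg_trans fl; apply: near_eq_cvg.
by apply: filterS fg => n ->.
Qed.

Lemma cvg_sin_ratio (R : realType) : (fun h : R => h^-1 * sin h) @ 0^' --> (1 : R).
Proof.
have d := is_derive_sin (0 : R).
have h : h^-1 *: ((sin \o shift 0) (h *: 1) - sin 0) @[h --> 0^'] --> (1 : R).
  rewrite -[X in _ --> X](cos0 R) -(@derive_val _ _ _ _ _ _ _ d).
  exact: (@ex_derive _ _ _ _ _ _ _ d).
apply: cvg_trans h; apply: near_eq_cvg; near=> x.
by rewrite /= sin0 subr0 addr0 /GRing.scale /= mulr1.
Unshelve. all: by end_near. Qed.

Lemma cvg_n_sin (R : realType) (c : R) : 0 < c ->
  (fun n : nat => n%:R * sin (c / n%:R)) @ \oo --> c.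
Proof.
move=> c0; rewrite -cvg_shiftS /=.
have /cvgr_dnbhsP h := @cvg_sin_ratio R.
have u0 : (fun n : nat => c / n.+1%:R) @ \oo --> (0 : R).
  rewrite -[X in _ --> X](mulr0 c); apply: cvgMl_tmp; exact: cvg_harmonic.
have uN0 n : c / n.+1%:R != 0 by rewrite mulf_neq0 ?gt_eqF // invr_gt0 ltr0n.
have : (fun n : nat => c * ((c / n.+1%:R)^-1 * sin (c / n.+1%:R))) @ \oo --> c * 1.
  by apply: cvgMl_tmp; exact: h (conj uN0 u0).
rewrite mulr1.
move=> /cvg_near_eq; apply; near=> n.
by rewrite /= invf_div mulrA mulrCA mulfV ?mulr1 // gt_eqF.
Unshelve. all: by end_near. Qed.

Lemma cvg_n2_cos (R : realType) :
  (fun n : nat => n%:R ^+ 2 * (1 - cos (pi / n%:R))) @ \oo --> (pi ^+ 2 / 2 : R).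
Proof.
have p0 : 0 < pi / 2 :> R by rewrite divr_gt0 ?pi_gt0.
have h := cvg_n_sin p0.
have : (fun n : nat => 2 * ((n%:R * sin (pi / 2 / n%:R)) * (n%:R * sin (pi / 2 / n%:R))))
    @ \oo --> (2 * (pi / 2 * (pi / 2)) : R) by apply: cvgMl_tmp; exact: cvgM.
have -> : 2 * (pi / 2 * (pi / 2)) = pi ^+ 2 / 2 :> R by field.
move=> /cvg_near_eq; apply; near=> n.
rewrite /=; set s := sin _.
have -> : pi / n%:R = (pi / 2 / n%:R) *+ 2 :> R.
  by rewrite -[RHS]mulr_natr [RHS]mulrAC divfK ?pnatr_eq0.
by rewrite cos_mulr2n cos2sin2 -/s -mulr_natr; ring.
Unshelve. all: by end_near. Qed.

Section Gap.
Variables (R : realType) (beta : nat -> R) (zeta : R).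
Hypothesis beta_gt0 : forall n, 0 < beta n.
Hypothesis beta_cvg : (fun n : nat => n%:R * beta n) @ \oo --> zeta.

Definition gap n : R := 1 - eigen (beta n) n.-1.

Lemma beta_cvg0 : beta @ \oo --> (0 : R).
Proof.
have : (fun n : nat => n%:R^-1 * (n%:R * beta n)) @ \oo --> 0 * zeta.
  by apply: cvgM => //; exact: cvg_invn.
rewrite mul0r.
move=> /cvg_near_eq; apply; near=> n.
have n0 : n%:R != 0 :> R by rewrite pnatr_eq0 -lt0n; near: n; exact: nbhs_infty_gt.
by rewrite /= mulKf.
Unshelve. all: by end_near. Qed.

Lemma cvg_sqrt_beta : (fun n => Num.sqrt (1 - beta n ^+ 2)) @ \oo --> (1 : R).
Proof.
rewrite -[X in _ --> X]sqrtr1; apply: continuous_cvg; first exact: sqrt_continuous.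
rewrite -[X in _ --> X]subr0 -[X in _ - X](mulr0 0).
by apply: cvgB; [exact: cvg_cst|exact: cvgM beta_cvg0 beta_cvg0].
Qed.

Lemma cvg_n2_sqrt :
  (fun n => n%:R ^+ 2 * (1 - Num.sqrt (1 - beta n ^+ 2))) @ \oo --> zeta ^+ 2 / 2.
Proof.
have h : (fun n => 1 + Num.sqrt (1 - beta n ^+ 2)) @ \oo --> (1 + 1 : R).
  by apply: cvgD; [exact: cvg_cst|exact: cvg_sqrt_beta].
have two0 : 1 + 1 != 0 :> R by rewrite gt_eqF // addr_gt0.
have : (fun n => n%:R * beta n * (n%:R * beta n) / (1 + Num.sqrt (1 - beta n ^+ 2)))
    @ \oo --> zeta * zeta / (1 + 1).
  by apply: cvgM; [exact: cvgM|exact: cvgV].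
have -> : zeta * zeta / (1 + 1) = zeta ^+ 2 / 2 by [].
move=> /cvg_near_eq; apply; near=> n.
have b1 : beta n < 1.
  by near: n; apply: (cvgr_lt _ beta_cvg0); exact: ltr01.
rewrite /=; have := sqr_sqrt1B (beta_gt0 n) b1; set s := Num.sqrt _ => hs.
have s0 : 1 + s != 0 by rewrite gt_eqF // ltr_pwDl // sqrtr_ge0.
apply: (mulIf s0); rewrite mulfVK //.
transitivity (n%:R ^+ 2 * (1 - s ^+ 2)); [by rewrite hs; ring|by ring].
Unshelve. all: by end_near. Qed.

Lemma gap_cvg : (fun n => n%:R ^+ 3 * gap n) @ \oo --> (pi ^+ 2 + zeta ^+ 2) / 2.
Proof.
have h1 : (fun n : nat => 1 + n.-1%:R^-1 : R) @ \oo --> (1 + 0 : R).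
  apply: cvgD; first exact: cvg_cst.
  by rewrite -cvg_shiftS /=; exact: cvg_invn.
have -> : (pi ^+ 2 + zeta ^+ 2) / 2 =
  (zeta ^+ 2 / 2 + 1 * (pi ^+ 2 / 2)) * (1 + 0) by field.
pose s n := Num.sqrt (1 - beta n ^+ 2).
have h2 : (fun n => (n%:R ^+ 2 * (1 - s n) + s n * (n%:R ^+ 2 * (1 - cos (pi / n%:R))))
    * (1 + n.-1%:R^-1)) @ \oo --> (zeta ^+ 2 / 2 + 1 * (pi ^+ 2 / 2)) * (1 + 0).
  apply: cvgM h1; apply: cvgD; first exact: cvg_n2_sqrt.
  by apply: cvgM; [exact: cvg_sqrt_beta|exact: cvg_n2_cos].
apply: (cvg_near_eq h2); near=> n.
have n2 : (1 < n)%N by near: n; exact: nbhs_infty_gt.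
have nE : n = n.-1.+1 by rewrite prednK // ltnW.
have m0 : n.-1%:R != 0 :> R by rewrite pnatr_eq0 -lt0n; lia.
rewrite /= /gap /eigen /edge_eigen -nE.
have -> : n%:R = n.-1%:R + 1 :> R by rewrite {1}nE natr1.
rewrite -/(s n); set c := cos _.
by field.
Unshelve. all: by end_near. Qed.

Lemma gap_cvg0 : gap @ \oo --> (0 : R).
Proof.
rewrite -[X in _ --> X](mul0r ((pi ^+ 2 + zeta ^+ 2) / 2)).
have i3 : (fun n : nat => n%:R^-1 ^+ 3) @ \oo --> (0 : R).
  rewrite -[X in _ --> X](expr0n _ 3).
  by apply: (@continuous_cvg _ _ _ _ _ _ (fun x : R => x ^+ 3));
    [exact: exprn_continuous|exact: cvg_invn].
have h : (fun n => n%:R^-1 ^+ 3 * (n%:R ^+ 3 * gap n)) @ \oo -->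
    0 * ((pi ^+ 2 + zeta ^+ 2) / 2).
  by apply: cvgM => //; exact: gap_cvg.
apply: (cvg_near_eq h); near=> n.
have n0 : n%:R != 0 :> R by rewrite pnatr_eq0 -lt0n; near: n; exact: nbhs_infty_gt.
by rewrite /=; field.
Unshelve. all: by end_near. Qed.

End Gap.

Lemma near_ln_ge (R : realType) (A : R) : \forall n \near \oo, A <= ln (n%:R : R).
Proof.
near=> n.
have h : expR A <= n%:R by near: n; exact: nbhs_infty_ger.
rewrite -[A]expRK ler_ln // posrE ?expR_gt0 //.
by apply: lt_le_trans h; exact: expR_gt0.
Unshelve. all: by end_near. Qed.

Lemma cvg_ln_ratio (R : realType) (a b : R) :
  (fun n : nat => (ln n%:R - a) / (ln n%:R + b)) @ \oo --> (1 : R).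
Proof.
have h : (fun n : nat => (ln (n%:R : R) + b)^-1) @ \oo --> (0 : R).
  apply/gtr0_cvgV0.
    near=> n; have : 1 - b <= ln (n%:R : R) by near: n; exact: near_ln_ge.
    by lra.
  apply/cvgryPge => A; near=> n.
  have : A - b <= ln (n%:R : R) by near: n; exact: near_ln_ge.
  by lra.
have h2 : (fun n : nat => 1 - (a + b) * (ln (n%:R : R) + b)^-1) @ \oo -->
    (1 - (a + b) * 0 : R).
  by apply: cvgB; [exact: cvg_cst|exact: cvgMl_tmp].
rewrite mulr0 subr0 in h2.
apply: (cvg_near_eq h2); near=> n.
have h3 : ln (n%:R : R) + b != 0.
  have : 1 - b <= ln (n%:R : R) by near: n; exact: near_ln_ge.
  by move=> ?; rewrite gt_eqF //; lra.
by rewrite /=; field.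
Unshelve. all: by end_near. Qed.

Lemma separation_length (R : realType) (rho : R) (n k : nat) : (3 < n)%N ->
  0 <= rho -> rho <= 1 / 2 -> rho / 2 * n%:R <= k%:R -> k%:R <= 3 / 4 * n%:R :> R ->
  exists L : nat, [/\ (L <= n %/ 4)%N, (L <= k)%N, (L + k <= n)%N
                    & rho / 8 * n%:R <= L%:R].
Proof.
move=> n3 rho_ge0 rho_le k1 k2; have n0 : 0 <= n%:R :> R by [].
have kn : (k <= n)%N by rewrite -(ler_nat R); lra.
have rn : rho * n%:R <= 1 / 2 * n%:R by rewrite ler_wpM2r.
have rn0 : 0 <= rho * n%:R by rewrite mulr_ge0.
have : (n <= 8 * (n %/ 4))%N by clear -n3; lia.
move: (n %/ 4)%N => h; rewrite -(ler_nat R) natrM => h8.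
exists (minn h (minn k (n - k))); split; try by clear -kn; lia.
rewrite -!minEnat !natr_min natrB // !le_min; apply/andP; split; first lra.
by apply/andP; split; lra.
Qed.

Lemma asym_exp_le (R : realType) (b z : R) (n : nat) :
  0 < b -> b <= 1 / 2 -> n%:R * b <= z -> asym b ^+ n <= expR (4 * z).
Proof.
move=> b0 b1 nb.
have a1 : asym b <= expR (4 * b).
  apply: le_trans (expR_ge1Dx _); rewrite /asym ler_pdivrMr; first nra.
  by lra.
apply: (@le_trans _ _ (expR (4 * b) ^+ n)).
  apply: lerXn2r => //; rewrite nnegrE ?expR_ge0 //.
  by apply: divr_ge0; lra.
by rewrite -expRM_natl ler_expR; nra.
Qed.

Lemma damp_exp_ge (R : realType) (b A : R) (n : nat) :
  0 < b -> b < 1 -> asym b ^+ n <= A -> A^-1 <= damp b ^+ n.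
Proof.
move=> b0 b1 hA.
have a0 : 0 < asym b ^+ n.
  by rewrite exprn_gt0 // (lt_trans ltr01) // asym_gt1.
apply: (@le_trans _ _ (damp b ^+ (2 * n))).
  rewrite exprM damp_sqr // exprVn lef_pV2 ?posrE //.
  exact: lt_le_trans hA.
have d0 := damp_gt0 b0 b1.
by rewrite ler_wiXn2l ?damp_le1 // ?ltW //; lia.
Qed.

Lemma expX_gap_ge (R : realType) (G : R) (t : nat) : G < 1 ->
  expR (- (2 * t%:R * (G / (1 - G)))) <= (1 - G) ^+ t ^+ 2.
Proof.
move=> G1.
have l0 : 0 < 1 - G by rewrite subr_gt0.
have h : expR (- (G / (1 - G))) <= 1 - G.
  rewrite expRN -[leRHS]invrK lef_pV2 ?posrE ?expR_gt0 ?invr_gt0 //.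
  apply: le_trans (expR_ge1Dx _).
  suff <- : (1 - G)^-1 = 1 + G / (1 - G) by [].
  by field; rewrite gt_eqF.
have -> : - (2 * t%:R * (G / (1 - G))) = (t * 2)%:R * - (G / (1 - G)).
  by rewrite natrM; ring.
rewrite expRM_natl -exprM; apply: lerXn2r => //; rewrite nnegrE ?expR_ge0 //.
exact: ltW.
Qed.

Lemma exclusion_time_lower (R : realType) (b A g0 c0 eps : R) (n k L : nat)
    (mu : config n k -> R) (t : nat) (G := 1 - eigen b n.-1)
    (C := 32 * A ^+ 2 / (g0 * c0 ^+ 2 * (1 - eps))) :
  (8 <= n)%N -> 0 < b -> b < 1 -> eps < 1 -> 0 < g0 -> 0 < c0 ->
  asym b ^+ n <= A -> g0 <= n%:R ^+ 3 * G -> G < 1 ->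
  (L <= n %/ 4)%N -> (L <= k)%N -> (L + k <= n)%N ->
  c0 * n%:R ^+ 2 <= (2 * (n %/ 4))%:R * (A^-1 * sin (pi / 8) * L%:R) ->
  stationary_distribution (@exclusion_kernel R b n k) mu ->
  worst_tv (@exclusion_kernel R b n k) mu t < eps ->
  (ln n%:R - ln C) * (1 - G) / (2 * G) <= t%:R.
Proof.
case: n mu @G => [//|m] mu /=; set G := 1 - eigen b m.
set n := m.+1 => n8 b0 b1 e1 g00 c00 aA gG G1 L1 L2 L3 hc mustat htv.
have m0 : (0 < m)%N by exact: leq_trans (n8 : (7 <= m)%N).
have [s1 [s2 hs]] := @wheight_separation R b m k b0 b1 L n8 L1 L2 L3.
have n0 : 0 < n%:R :> R by rewrite ltr0n.
have G0 : 0 < G.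
  by rewrite -(pmulr_rgt0 _ (exprn_gt0 3 n0)); exact: lt_le_trans g00 gG.
have lE : eigen b m = 1 - G by rewrite /G opprB addrC subrK.
have l0 : 0 < eigen b m by rewrite lE subr_gt0.
have l1 : eigen b m < 1 by rewrite lE; lra.
have sin0 : 0 <= sin (pi / 8) :> R.
  by apply: sin_ge0_pi; have := pi_gt0 R; move=> ?; apply/andP; split; lra.
have A0 : 0 < A.
  by apply: lt_le_trans aA; rewrite exprn_gt0 // (lt_trans ltr01) // asym_gt1.
have Dle : c0 * n%:R ^+ 2 <= wheight b (val s1) - wheight b (val s2).
  apply: le_trans hs; apply: le_trans hc _.
  apply: ler_wpM2l => //; apply: ler_wpM2r => //; apply: ler_wpM2r => //.
  exact: damp_exp_ge.
have D0 : 0 < c0 * n%:R ^+ 2 by rewrite mulr_gt0 // exprn_gt0.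
have := le_lt_trans (exclusion_tv_lower b0 b1 m0 t l0 l1 D0 Dle mustat) htv.
rewrite lE => htv'; rewrite leNgt; apply/negP => ht.
have e0 : 0 < 1 - eps by rewrite subr_gt0.
have C0 : 0 < C.
  apply: divr_gt0; first by apply: mulr_gt0 => //; exact: exprn_gt0.
  by apply: mulr_gt0 => //; apply: mulr_gt0 => //; exact: exprn_gt0.
have ht2 : 2 * t%:R * (G / (1 - G)) < ln n%:R - ln C.
  rewrite mulrA ltr_pdivrMr ?subr_gt0 //.
  rewrite ltr_pdivlMr in ht; last by rewrite mulr_gt0.
  by have -> : 2 * t%:R * G = t%:R * (2 * G) by ring.
have lt2 : C / n%:R < (1 - G) ^+ t ^+ 2.
  apply: lt_le_trans (expX_gap_ge t G1).
  have -> : C / n%:R = expR (ln C - ln n%:R) by rewrite expRD expRN !lnK ?posrE.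
  by rewrite ltr_expR; lra.
set X := (1 - G) ^+ t ^+ 2 in lt2 htv'.
have hl : G <= 1 - (1 - G) ^+ 2 by clear -G0 G1; nra.
have a2 : asym b ^+ (2 * n) <= A ^+ 2.
  rewrite mulnC exprM; apply: lerXn2r; rewrite ?nnegrE ?(ltW A0) //.
  by rewrite exprn_ge0 // ltW // (lt_trans ltr01) // asym_gt1.
have lower : 32 * A ^+ 2 / (1 - eps) <
    (1 - (1 - G) ^+ 2) * X * (c0 * n%:R ^+ 2) ^+ 2.
  have -> : 32 * A ^+ 2 / (1 - eps) =
      (g0 / n%:R ^+ 3) * (C / n%:R) * (c0 * n%:R ^+ 2) ^+ 2.
    rewrite /C; field; rewrite !gt_eqF // subr_gt0 //.
  rewrite ltr_pM2r ?exprn_gt0 //.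
  apply: (@le_lt_trans _ _ ((1 - (1 - G) ^+ 2) * (C / n%:R))).
    apply: ler_wpM2r; first by rewrite ltW // divr_gt0.
    by apply: le_trans hl; rewrite ler_pdivrMr ?exprn_gt0 // mulrC.
  by rewrite ltr_pM2l //; exact: lt_le_trans hl.
set Q := _ * X * _ in lower htv'.
have Q0 : 0 < Q.
  apply: le_lt_trans lower; rewrite divr_ge0 ?(ltW e0) // mulr_ge0 //.
  exact: sqr_ge0.
have := htv'; rewrite ltrBlDl -ltrBlDr ltr_pdivlMr //.
rewrite ltr_pdivrMr // in lower.
clear -a2 lower; lra.
Qed.

Theorem proposition6 (R : realType) (beta : nat -> R) (k : nat -> nat)
    (rho zeta : R)
    (beta_gt0 : forall n : nat, 0 < beta n)
    (rho_gt0 : 0 < rho) (rho_le : rho <= 1 / 2)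
    (k_cvg : (fun n : nat => (k n)%:R / n%:R : R) @ \oo --> rho)
    (zeta_ge0 : 0 <= zeta)
    (beta_cvg : (fun n : nat => n%:R * beta n) @ \oo --> zeta)
    (eps : R) (eps_gt0 : 0 < eps) (eps_lt1 : eps < 1) :
  exists o : nat -> R,
    o @ \oo --> (0 : R) /\
    \forall n \near \oo,
      forall mu : config n (k n) -> R,
        stationary_distribution (@exclusion_kernel R (beta n) n (k n)) mu ->
        ((n%:R ^+ 3 / (pi ^+ 2 + zeta ^+ 2) * (1 + o n)
            * (ln n%:R + ln ((1 - eps) / eps)))%:E
         <= tmix (@exclusion_kernel R (beta n) n (k n)) mu eps)%E.
Proof.
have pi0 := pi_gt0 R.
have kap0 : 0 < sin (pi / 8) :> R.
  by apply: sin_gt0_pi; apply/andP; split; lra.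
pose S : R := pi ^+ 2 + zeta ^+ 2.
have S0 : 0 < S by rewrite ltr_pwDl ?sqr_ge0 // exprn_gt0.
pose A := expR (4 * (zeta + 1)).
have A0 : 0 < A := expR_gt0 _.
pose g0 := S / 4.
have g00 : 0 < g0 by rewrite divr_gt0.
have g0S : g0 < S / 2 by rewrite /g0 ltr_pM2l // ltf_pV2 ?posrE // ltr_nat.
pose c0 := sin (pi / 8) * rho / (32 * A).
have c00 : 0 < c0 by rewrite divr_gt0 // mulr_gt0.
pose C := 32 * A ^+ 2 / (g0 * c0 ^+ 2 * (1 - eps)).
pose a := ln C; pose b := ln ((1 - eps) / eps).
pose G := gap beta.
(* chosen so that the claimed bound is exactly (ln n - a) (1 - G n) / (2 G n) *)
exists (fun n => (ln n%:R - a) / (ln n%:R + b) * (S / 2 / (n%:R ^+ 3 * G n / (1 - G n))) - 1).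
have gc := gap_cvg beta_gt0 beta_cvg.
have gc0 := gap_cvg0 beta_gt0 beta_cvg.
split.
  have -> : 0 = 1 * (S / 2 / (S / 2 / (1 - 0))) - 1 :> R.
    by rewrite subr0 divr1 mul1r divff ?subrr // gt_eqF // divr_gt0.
  apply: cvgB; last exact: cvg_cst.
  apply: cvgM; first exact: cvg_ln_ratio.
  apply: cvgM; first exact: cvg_cst.
  apply: cvgV; first by rewrite subr0 divr1 gt_eqF // divr_gt0.
  apply: cvgM; first exact: gc.
  apply: cvgV; first by rewrite subr0 oner_neq0.
  by apply: cvgB; [exact: cvg_cst|exact: gc0].
have gG_near : \forall n \near \oo, g0 <= n%:R ^+ 3 * G n.
  by apply: (cvgr_ge _ gc); exact: g0S.
have k_near : \forall n \near \oo, rho / 2 <= (k n)%:R / n%:R.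
  by apply: (cvgr_ge _ k_cvg); lra.
have k_near' : \forall n \near \oo, (k n)%:R / n%:R <= 3 / 4 :> R.
  by apply: (cvgr_le _ k_cvg); lra.
near=> n => mu mustat.
have n8 : (8 <= n)%N by near: n; exact: nbhs_infty_ge.
have n0 : 0 < n%:R :> R by rewrite ltr0n (leq_trans _ n8).
have b1 : beta n <= 1 / 2.
  by near: n; apply: (cvgr_le _ (beta_cvg0 beta_cvg)); lra.
have nb : n%:R * beta n <= zeta + 1.
  by near: n; apply: (cvgr_le _ beta_cvg); lra.
have gG : g0 <= n%:R ^+ 3 * G n.
  by near: n; exact: gG_near.
have G1 : G n < 1 by near: n; apply: (cvgr_lt _ gc0); exact: ltr01.
have k1 : rho / 2 <= (k n)%:R / n%:R.
  by near: n; exact: k_near.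
have k2 : (k n)%:R / n%:R <= 3 / 4 :> R.
  by near: n; exact: k_near'.
have lnb : 1 <= ln n%:R + b.
  have : 1 - b <= ln (n%:R : R) by near: n; exact: near_ln_ge.
  by lra.
have G0 : 0 < G n.
  by rewrite -(pmulr_rgt0 _ (exprn_gt0 3 n0)); exact: lt_le_trans g00 gG.
rewrite ler_pdivlMr // in k1; rewrite ler_pdivrMr // in k2.
have [L [L1 L2 L3 hL]] :=
  separation_length (leq_trans (isT : 4 <= 8)%N n8) (ltW rho_gt0) rho_le k1 k2.
rewrite /tmix; apply: le_ereal_inf_tmp => _ [t /= ht <-]; rewrite lee_fin.
have -> : n%:R ^+ 3 / (pi ^+ 2 + zeta ^+ 2) * (1 + ((ln n%:R - a) / (ln n%:R + b)
    * (S / 2 / (n%:R ^+ 3 * G n / (1 - G n))) - 1)) * (ln n%:R + ln ((1 - eps) / eps))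
   = (ln n%:R - a) * (1 - G n) / (2 * G n).
  rewrite -/S -/b; field.
  by rewrite !gt_eqF // ?subr_gt0 // (lt_le_trans ltr01 lnb).
apply: (@exclusion_time_lower R (beta n) A g0 c0 eps n (k n) L mu t) => //.
- by clear -b1; lra.
- exact: asym_exp_le.
have -> : c0 * n%:R ^+ 2 = 2 * (n%:R / 8) * (A^-1 * sin (pi / 8) * (rho / 8 * n%:R)).
  by rewrite /c0; field; rewrite gt_eqF.
have As0 : 0 < A^-1 * sin (pi / 8) by rewrite mulr_gt0 // invr_gt0.
apply: ler_pM.
- by rewrite mulr_ge0 // divr_ge0 // ltW.
- apply: mulr_ge0; first exact: ltW.
  by apply: mulr_ge0; [rewrite divr_ge0 // ltW|exact: ltW].
- rewrite natrM ler_pM2l // ler_pdivrMr // -natrM ler_nat mulnC.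
  by clear -n8; lia.
- by rewrite ler_wpM2l // ltW.
Unshelve. all: by end_near. Qed.
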